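(* Let $(M^5,g,\xi,\eta,\varphi)$ be an almost contact metric $5$-manifold of class $\mathcal W_4\oplus\mathcal W_7$. Then $$d\eta(\varphi(X),\varphi(Y))=-d\eta(X,Y)$$ for all vector fields $X,Y$.
   Context: An almost contact metric structure on a Riemannian $5$-manifold $(M^5,g)$ is a triple $(\xi,\eta,\varphi)$: a unit vector field $\xi$, its dual $1$-form $\eta$, and an endomorphism $\varphi$ of $TM^5$ with $\varphi(\xi)=0$, $\varphi^2=-\mathrm{Id}+\eta\otimes\xi$, $g(\varphi(X),\varphi(Y))=g(X,Y)-\eta(X)\eta(Y)$. Its fundamental form is $\Phi(X,Y):=g(X,\varphi(Y))$; locally there are oriented orthonormal (''adapted'') frames $(e_1,\dots,e_5)$ with $\Phi=e_1\wedge e_2+e_3\wedge e_4$, $\eta=e_5$ ($TM^5$ is identified with its dual via $g$), and these fix the orientation. $\nabla^g$ is the Levi-Civita connection and $d\eta(X,Y)=(\nabla^g_X\eta)(Y)-(\nabla^g_Y\eta)(X)$. Classes. Identify $\mathfrak{so}(5)$ with $\Lambda^2$. With $\ast$ the Hodge operator, $\Lambda^2=\Lambda^2_1\oplus\Lambda^2_2\oplus\Lambda^2_3\oplus\Lambda^2_4$, where $\Lambda^2_1=\{t\Phi\mid t\in\mathbb R\}$, $\Lambda^2_2=\{\beta\mid\Phi\wedge\beta=0,\ \ast\beta=\eta\wedge\beta\}$, $\Lambda^2_3=\{\beta\mid\ast\beta=-\eta\wedge\beta\}$, $\Lambda^2_4=\{\beta\mid\eta\wedge\beta=0\}$; then $\mathfrak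 u(2)=\Lambda^2_1\oplus\Lambda^2_3$ and $\mathfrak u(2)^\perp=\Lambda^2_2\oplus\Lambda^2_4$. With $\omega^g_{ij}=g(\nabla^ge_i,e_j)$ for an adapted frame and $\Omega^g=(\omega^g_{ij})$, the intrinsic torsion is $\Gamma(X):=\mathrm{pr}_{\mathfrak u(2)^\perp}(\Omega^g(X))$, a section of $\mathcal W:=\Lambda^1\otimes\mathfrak u(2)^\perp$, regarded as a $(3,0)$-tensor skew in its last two arguments. Let $\theta(\beta)(X,Y,Z):=\ast\beta(X,Y,Z)$ and $\vartheta(\beta)(X,Y,Z):=3\,\eta(X)\beta(Y,Z)-\ast\beta(X,Y,Z)$ for $\beta\in\Lambda^2$. Then $\mathcal W_4=\theta(\Lambda^2_2)\subset\mathcal W$ and $\mathcal W_7=\vartheta(\Lambda^2_2)\subset\mathcal W$. The manifold is of class $\mathcal W_4\oplus\mathcal W_7$ if $\Gamma\in\mathcal W_4\oplus\mathcal W_7$ at every point. *)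

(* Defs.v *)
From HB Require Import structures.
From mathcomp Require Import all_boot all_order all_algebra.
From mathcomp Require Import all_classical all_reals all_analysis.
Set Implicit Arguments.
Unset Strict Implicit.
Unset Printing Implicit Defensive.
Import Order.TTheory GRing.Theory Num.Theory.
Import numFieldNormedType.Exports.
Local Open Scope classical_set_scope.
Local Open Scope ring_scope.

(* Manifolds are given by an atlas, and tensor fields
   by their components in the charts, subject to the usual transformation
   rules.  Tangent vectors are row vectors, and linear maps act on the right. *)

Section Smooth.
Variables (R : realType) (n : nat) (W : normedModType R).

Definition basis_vec (i : 'I_n) : 'rV[R]_n := delta_mx 0 i.

(* On an open set U, [smooth_upto k.+1 U f] says that f is differentiable and
   that its partial derivatives are C^k, i.e. that f is C^(k+1). *)
Fixpoint smooth_upto (k : nat) (U : set 'rV[R]_n) (f : 'rV[R]_n -> W) : Prop :=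
  if k is k'.+1 then
    (forall x, U x -> differentiable f x) /\
    (forall i, smooth_upto k' U (fun x => 'D_(basis_vec i) f x))
  else forall x, U x -> {for x, continuous f}.

Definition smooth_on (U : set 'rV[R]_n) (f : 'rV[R]_n -> W) : Prop :=
  forall k, smooth_upto k U f.

End Smooth.

(* [param c] is the inverse of the chart map [coords c]; the values of
   [coords c] outside [dom c], and of [param c] outside the image, are
   irrelevant. *)
Record smooth_manifold (R : realType) (n : nat) := SmoothManifold {
  carrier :> topologicalType;
  manifold_hausdorff : hausdorff_space carrier;
  manifold_second_countable : @second_countable carrier;
  chart : Type;
  dom : chart -> set carrier;
  coords : chart -> carrier -> 'rV[R]_n;
  param : chart -> 'rV[R]_n -> carrier;
  dom_cover : forall p, exists c, dom c p;
  dom_open : forall c, open (dom c);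
  image_open : forall c, open (coords c @` dom c);
  coordsK : forall c p, dom c p -> param c (coords c p) = p;
  coords_continuous : forall c, {within dom c, continuous (coords c)};
  param_continuous : forall c, {within coords c @` dom c, continuous (param c)};
  transition_smooth : forall c d,
    smooth_on (coords c @` (dom c `&` dom d)) (coords d \o param c)
}.

Section Fields.
Variables (R : realType) (n : nat) (M : smooth_manifold R n).

(* The part of the image of the chart c lying over U. *)
Definition region (c : chart M) (U : set M) : set 'rV[R]_n :=
  coords c @` (dom c `&` U).

Definition jac (c d : chart M) (p : M) : 'M[R]_n :=
  jacobian (coords d \o param c) (coords c p).

(* Components of a field with values in V: X c x is the value, in the chart c,
   at the point with coordinates x. *)
Definition components (V : Type) := chart M -> 'rV[R]_n -> V.

Definition is_vector_field (U : set M) (X : components 'rV[R]_n) : Prop :=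
  (forall c, smooth_on (region c U) (X c)) /\
  (forall c d p, dom c p -> dom d p -> U p ->
     X d (coords d p) = X c (coords c p) *m jac c d p).

Definition is_one_form (a : components 'rV[R]_n) : Prop :=
  (forall c, smooth_on (region c setT) (a c)) /\
  (forall c d p, dom c p -> dom d p ->
     a c (coords c p) = a d (coords d p) *m (jac c d p)^T).

Definition is_endomorphism (f : components 'M[R]_n) : Prop :=
  (forall c, smooth_on (region c setT) (f c)) /\
  (forall c d p, dom c p -> dom d p ->
     f c (coords c p) *m jac c d p = jac c d p *m f d (coords d p)).

Definition is_bilinear_form (b : components 'M[R]_n) : Prop :=
  (forall c, smooth_on (region c setT) (b c)) /\
  (forall c d p, dom c p -> dom d p ->
     b c (coords c p) = jac c d p *m b d (coords d p) *m (jac c d p)^T).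

Definition bilin (b : 'M[R]_n) (u v : 'rV[R]_n) : R := (u *m b *m v^T) 0 0.

Definition pairing (a v : 'rV[R]_n) : R := (a *m v^T) 0 0.

Record riemannian_metric := RiemannianMetric {
  metric : components 'M[R]_n;
  metric_form : is_bilinear_form metric;
  metric_sym : forall c x, region c setT x -> (metric c x)^T = metric c x;
  metric_pos : forall c x v, region c setT x -> v != 0 ->
    0 < bilin (metric c x) v v
}.

Variable g : riemannian_metric.

(* partial derivative d_i g_jl *)
Definition dmetric (c : chart M) (x : 'rV[R]_n) (i j l : 'I_n) : R :=
  'D_(basis_vec R i) (fun y => metric g c y j l) x.

Definition christoffel (c : chart M) (x : 'rV[R]_n) (k i j : 'I_n) : R :=
  2^-1 * \sum_l invmx (metric g c x) k l *
    (dmetric c x i j l + dmetric c x j i l - dmetric c x l i j).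

(* Levi-Civita covariant derivative of the field Y along X *)
Definition nabla (X Y : components 'rV[R]_n) : components 'rV[R]_n :=
  fun c x => 'D_(X c x) (Y c) x +
    \row_k \sum_i \sum_j christoffel c x k i j * X c x 0 i * Y c x 0 j.

Definition eval_form (a X : components 'rV[R]_n) : components R :=
  fun c x => pairing (a c x) (X c x).

Definition apply_endo (f : components 'M[R]_n) (X : components 'rV[R]_n) :
    components 'rV[R]_n :=
  fun c x => X c x *m f c x.

(* (nabla_X a)(Y) *)
Definition nabla_form (a X Y : components 'rV[R]_n) : components R :=
  fun c x => 'D_(X c x) (eval_form a Y c) x - eval_form a (nabla X Y) c x.

Definition ext_deriv (a X Y : components 'rV[R]_n) : components R :=
  fun c x => nabla_form a X Y c x - nabla_form a Y X c x.

End Fields.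

Record almost_contact_metric (R : realType) (M : smooth_manifold R 5)
    (g : riemannian_metric M) := AlmostContactMetric {
  acm_xi : components M 'rV[R]_5;
  acm_eta : components M 'rV[R]_5;
  acm_phi : components M 'M[R]_5;
  xi_field : is_vector_field setT acm_xi;
  eta_form : is_one_form acm_eta;
  phi_endo : is_endomorphism acm_phi;
  xi_unit : forall c x, region c setT x ->
    bilin (metric g c x) (acm_xi c x) (acm_xi c x) = 1;
  eta_dual : forall c x v, region c setT x ->
    pairing (acm_eta c x) v = bilin (metric g c x) (acm_xi c x) v;
  phi_xi : forall c x, region c setT x -> acm_xi c x *m acm_phi c x = 0;
  phi_square : forall c x v, region c setT x ->
    v *m acm_phi c x *m acm_phi c x =
    - v + pairing (acm_eta c x) v *: acm_xi c x;
  phi_metric : forall c x u v, region c setT x ->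
    bilin (metric g c x) (u *m acm_phi c x) (v *m acm_phi c x) =
    bilin (metric g c x) u v -
    pairing (acm_eta c x) u * pairing (acm_eta c x) v
}.

(* Algebra of R^5 with its standard adapted basis.  The vectors e_1, ..., e_5
   are indexed by 0, ..., 4; 2-forms are skew matrices. *)
Section Model.
Variable R : realType.

Definition e_ (i : nat) : 'I_5 := inord i.-1.

Definition wedge11 (i j : 'I_5) : 'M[R]_5 := delta_mx i j - delta_mx j i.

Definition Phi0 : 'M[R]_5 :=
  wedge11 (e_ 1) (e_ 2) + wedge11 (e_ 3) (e_ 4).

Definition eta0 : 'rV[R]_5 := delta_mx 0 (e_ 5).

Definition wedge12 (a : 'rV[R]_5) (b : 'M[R]_5) (i j k : 'I_5) : R :=
  a 0 i * b j k + a 0 j * b k i + a 0 k * b i j.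

Definition wedge22 (a b : 'M[R]_5) (i j k l : 'I_5) : R :=
  a i j * b k l - a i k * b j l + a i l * b j k +
  a j k * b i l - a j l * b i k + a k l * b i j.

(* Levi-Civita symbol of the sequence i, j, k, l, m *)
Definition epsilon (i j k l m : 'I_5) : R :=
  \det (\matrix_(a < 5, b < 5) (tnth [tuple i; j; k; l; m] a == b)%:R).

(* Hodge star of a 2-form, for the orientation e_1 /\ ... /\ e_5 *)
Definition star (b : 'M[R]_5) (i j k : 'I_5) : R :=
  2^-1 * \sum_l \sum_m b l m * epsilon l m i j k.

Definition two_form (b : 'M[R]_5) : Prop := b^T = - b.

Definition Lambda2_1 : set 'M[R]_5 := [set t *: Phi0 | t in [set: R]].

Definition Lambda2_2 : set 'M[R]_5 :=
  [set b | [/\ two_form b,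
               forall i j k l, wedge22 Phi0 b i j k l = 0
             & forall i j k, star b i j k = wedge12 eta0 b i j k]].

Definition Lambda2_3 : set 'M[R]_5 :=
  [set b | two_form b /\
           forall i j k, star b i j k = - wedge12 eta0 b i j k].

Definition Lambda2_4 : set 'M[R]_5 :=
  [set b | two_form b /\ forall i j k, wedge12 eta0 b i j k = 0].

Definition u2 : set 'M[R]_5 :=
  [set a + b | a in Lambda2_1 & b in Lambda2_3].

Definition u2_perp : set 'M[R]_5 :=
  [set a + b | a in Lambda2_2 & b in Lambda2_4].

(* The u2_perp component along the decomposition so(5) = u2 + u2_perp. *)
Definition pr_u2_perp (b : 'M[R]_5) : 'M[R]_5 :=
  xget 0 [set a | u2_perp a /\ u2 (b - a)].

(* (3,0)-tensors, by their components in the basis *)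
Definition tensor3 := 'I_5 -> 'I_5 -> 'I_5 -> R.

Definition theta (b : 'M[R]_5) : tensor3 := fun i j k => star b i j k.

Definition vartheta (b : 'M[R]_5) : tensor3 :=
  fun i j k => 3 * eta0 0 i * b j k - star b i j k.

Definition W4 : set tensor3 := [set theta b | b in Lambda2_2].

Definition W7 : set tensor3 := [set vartheta b | b in Lambda2_2].

Definition W4_plus_W7 : set tensor3 :=
  [set T | exists S1 S2, [/\ W4 S1, W7 S2 &
                         forall i j k, T i j k = S1 i j k + S2 i j k]].

End Model.

Section Classes.
Variables (R : realType) (M : smooth_manifold R 5) (g : riemannian_metric M).
Variable A : almost_contact_metric g.

(* fundamental form Phi(u, v) = g(u, phi v) *)
Definition fundamental_form (c : chart M) (x u v : 'rV[R]_5) : R :=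
  bilin (metric g c x) u (v *m acm_phi A c x).

(* Smooth local frames on U with Phi = e_1 /\ e_2 + e_3 /\ e_4, eta = e_5. *)
Definition adapted_frame (U : set M) (e : 'I_5 -> components M 'rV[R]_5) :=
  (forall i, is_vector_field U (e i)) /\
  (forall c x, region c U x -> forall i j,
     [/\ bilin (metric g c x) (e i c x) (e j c x) = (i == j)%:R,
         fundamental_form c x (e i c x) (e j c x) = Phi0 R i j
       & pairing (acm_eta A c x) (e j c x) = eta0 R 0 j]).

(* The matrix (omega_ij(e_k))_ij of connection forms of the frame e. *)
Definition Omega (e : 'I_5 -> components M 'rV[R]_5) (c : chart M)
    (x : 'rV[R]_5) (k : 'I_5) : 'M[R]_5 :=
  \matrix_(i, j) bilin (metric g c x) (nabla g (e k) (e i) c x) (e j c x).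

Definition intrinsic_torsion (e : 'I_5 -> components M 'rV[R]_5)
    (c : chart M) (x : 'rV[R]_5) : tensor3 R :=
  fun k i j => pr_u2_perp (Omega e c x k) i j.

(* Adapted frames exist around every point, and neither the choice of the frame
   nor that of the chart affects the condition on the intrinsic torsion. *)
Definition of_class_W4_W7 : Prop :=
  forall p : M, exists U e,
    [/\ open U, U p, adapted_frame U e &
        forall c, dom c p ->
          W4_plus_W7 (intrinsic_torsion e c (coords c p))].

End Classes.

(* Main.v *)
Require Import Defs.
From HB Require Import structures.
From mathcomp Require Import all_boot all_order all_algebra.
From mathcomp Require Import all_classical all_reals all_analysis.
From mathcomp Require Import ring lra.
Set Implicit Arguments.
Unset Strict Implicit.
Unset Printing Implicit Defensive.
Import Order.TTheory GRing.Theory Num.Theory.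
Import numFieldNormedType.Exports.
Local Open Scope classical_set_scope.
Local Open Scope ring_scope.

(** Let e_1, ..., e_5 be an adapted frame, so that xi = e_5 and eta(e_j) is
    constant.  Then (nabla_{e_k} eta)(e_j) = - eta(nabla_{e_k} e_j)
    = - Omega(e_k)_{j5}.  Forms in u(2) have no component along e_5, hence
    Omega(e_k)_{j5} = Gamma(k, j, 5); here metric compatibility of nabla enters,
    since only skew matrices Omega(e_k) have a component in u(2)^perp.  For beta
    in Lambda^2_2 one has *beta = eta /\ beta, so theta(beta)(k, j, 5) = beta_kj and
    vartheta(beta)(k, j, 5) = - beta_kj.  In class W_4 + W_7 therefore
    Gamma(k, j, 5) = b_kj with b in Lambda^2_2, and d eta = - 2 b.  Finally Lambda^2_2
    is spanned by e_13 - e_24 and e_14 + e_23, which satisfy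
    b (phi u, phi v) = - b (u, v). *)

(** * Sums, products and case distinction over the five basis indices *)

Lemma sum_e (V : nmodType) (F : 'I_5 -> V) :
  \sum_i F i = F (e_ 1) + F (e_ 2) + F (e_ 3) + F (e_ 4) + F (e_ 5).
Proof.
rewrite !big_ord_recr big_ord0 /= add0r.
by congr (_ + _ + _ + _ + _); congr F; apply/val_inj; rewrite /= inordK.
Qed.

Lemma prod_e (S : pzSemiRingType) (F : 'I_5 -> S) :
  \prod_i F i = F (e_ 1) * F (e_ 2) * F (e_ 3) * F (e_ 4) * F (e_ 5).
Proof.
rewrite !big_ord_recr big_ord0 /= mul1r.
by congr (_ * _ * _ * _ * _); congr F; apply/val_inj; rewrite /= inordK.
Qed.

(** Used as [elim/forall_e]: the five goals carry their index in the form [e_ i], which the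
    rewriting lemmas match. *)
Lemma forall_e (P : 'I_5 -> Prop) :
  P (e_ 1) -> P (e_ 2) -> P (e_ 3) -> P (e_ 4) -> P (e_ 5) -> forall i, P i.
Proof.
move=> P1 P2 P3 P4 P5 [[|[|[|[|[|//]]]]] hi].
- by rewrite (_ : Ordinal hi = e_ 1)//; apply/val_inj; rewrite /= inordK.
- by rewrite (_ : Ordinal hi = e_ 2)//; apply/val_inj; rewrite /= inordK.
- by rewrite (_ : Ordinal hi = e_ 3)//; apply/val_inj; rewrite /= inordK.
- by rewrite (_ : Ordinal hi = e_ 4)//; apply/val_inj; rewrite /= inordK.
- by rewrite (_ : Ordinal hi = e_ 5)//; apply/val_inj; rewrite /= inordK.
Qed.

(** * The Levi-Civita symbol as a Vandermonde product *)

Section Model.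
Variable R : realType.

(* The matrix defining [epsilon] turns the Vandermonde matrix of 0, ..., 4, whose
   determinant is 288, into the Vandermonde matrix of the indices. *)
Lemma epsilon_Vandermonde (i j k l m : 'I_5) :
  let x (a : 'I_5) : R := a%:R in
  288 * epsilon R i j k l m =
  (x j - x i) * (x k - x i) * (x l - x i) * (x m - x i) *
  (x k - x j) * (x l - x j) * (x m - x j) *
  (x l - x k) * (x m - x k) * (x m - x l).
Proof.
move=> x.
pose t a := tnth [tuple i; j; k; l; m] a.
pose P : 'M[R]_5 := \matrix_(a < 5, b < 5) (t a == b)%:R.
have detV (s : 'I_5 -> 'I_5) : \det (Vandermonde 5 (\row_a x (s a))) =
    \prod_(a < 5) \prod_(b < 5 | (a < b)%N) (x (s b) - x (s a)).
  by rewrite det_Vandermonde; apply: eq_bigr => a _; apply: eq_bigr => b _;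
    rewrite !mxE.
have VP : Vandermonde 5 (\row_a x a) *m P^T = Vandermonde 5 (\row_a x (t a)).
  apply/matrixP => a b; rewrite !mxE (bigD1 (t b))//= !mxE eqxx mulr1.
  by rewrite big1 ?addr0// => c ct; rewrite !mxE eq_sym (negbTE ct) mulr0.
move: (congr1 determinant VP).
rewrite det_mulmx det_tr (detV id) (detV t) !prod_e.
rewrite !(big_mkcond (fun b : 'I_5 => (_ < b)%N)) !prod_e /=.
rewrite !inordK//= /t !(tnth_nth i) /= !inordK//= !mul1r !mulr1 !mulrA => <-.
rewrite /x !inordK//= -[epsilon _ _ _ _ _ _]/(\det P).
ring.
Qed.

(** * Skew matrices and alternating tensors *)

Lemma two_formP (b : 'M[R]_5) : two_form b <-> forall i j, b j i = - b i j.
Proof.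
split=> [/matrixP h i j|h]; first by have := h i j; rewrite !mxE.
by apply/matrixP => i j; rewrite !mxE.
Qed.

Definition alternating3 (T : tensor3 R) :=
  (forall i j k, T j i k = - T i j k) /\ (forall i j k, T i k j = - T i j k).

(** Adjacent transpositions sort every triple, and a repeated index makes the value its own
    negative; this leaves the ten increasing triples. *)
Lemma alternating3_eq (T S : tensor3 R) :
  alternating3 T -> alternating3 S ->
  T (e_ 1) (e_ 2) (e_ 3) = S (e_ 1) (e_ 2) (e_ 3) ->
  T (e_ 1) (e_ 2) (e_ 4) = S (e_ 1) (e_ 2) (e_ 4) ->
  T (e_ 1) (e_ 2) (e_ 5) = S (e_ 1) (e_ 2) (e_ 5) ->
  T (e_ 1) (e_ 3) (e_ 4) = S (e_ 1) (e_ 3) (e_ 4) ->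
  T (e_ 1) (e_ 3) (e_ 5) = S (e_ 1) (e_ 3) (e_ 5) ->
  T (e_ 1) (e_ 4) (e_ 5) = S (e_ 1) (e_ 4) (e_ 5) ->
  T (e_ 2) (e_ 3) (e_ 4) = S (e_ 2) (e_ 3) (e_ 4) ->
  T (e_ 2) (e_ 3) (e_ 5) = S (e_ 2) (e_ 3) (e_ 5) ->
  T (e_ 2) (e_ 4) (e_ 5) = S (e_ 2) (e_ 4) (e_ 5) ->
  T (e_ 3) (e_ 4) (e_ 5) = S (e_ 3) (e_ 4) (e_ 5) ->
  forall i j k, T i j k = S i j k.
Proof.
move=> [T1 T2] [S1 S2].
pose E i j k := T i j k = S i j k.
have s1 i j k : E j i k -> E i j k by rewrite /E T1 S1 => /oppr_inj.
have s2 i j k : E i k j -> E i j k by rewrite /E T2 S2 => /oppr_inj.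
have d1 i k : E i i k by rewrite /E; have := T1 i i k; have := S1 i i k; lra.
rewrite -!/(E _ _ _) => h1 h2 h3 h4 h5 h6 h7 h8 h9 h10 i j k.
by move: i j k; do 3 elim/forall_e; rewrite -/(E _ _ _); auto 6 using s1, s2, d1.
Qed.

Lemma alternating3_wedge12 (a : 'rV[R]_5) (b : 'M[R]_5) :
  two_form b -> alternating3 (wedge12 a b).
Proof.
move=> /two_formP sb; split=> i j k; rewrite /wedge12.
  by rewrite (sb i j) (sb j k) (sb k i); ring.
by rewrite (sb i j) (sb j k) (sb k i); ring.
Qed.

(** Transposing two indices flips the sign of the Vandermonde product; dividing out 288 transfers
    this to [epsilon]. *)
Lemma alternating3_star (b : 'M[R]_5) : alternating3 (star b).
Proof.
have n288 : 288 != 0 :> R by rewrite pnatr_eq0.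
split=> i j k; rewrite /star -mulrN -sumrN; congr (_ * _); apply: eq_bigr => l _;
  rewrite -sumrN; apply: eq_bigr => m _; rewrite -mulrN; congr (_ * _);
  apply: (mulfI n288); rewrite mulrN !epsilon_Vandermonde; ring.
Qed.

(** * Values of eta, the Hodge star and Phi on the basis *)

Lemma eta0_e : [/\ eta0 R 0 (e_ 1) = 0, eta0 R 0 (e_ 2) = 0, eta0 R 0 (e_ 3) = 0,
  eta0 R 0 (e_ 4) = 0 & eta0 R 0 (e_ 5) = 1].
Proof. by split; rewrite !mxE -!val_eqE /= !inordK. Qed.

(* The sign of a sequence of five numbers, as a closed term that reduces by
   computation: (-1) to the number of inversions. *)
Definition perm_sign (s : seq nat) : int :=
  if uniq s then
    (-1) ^+ sumn [seq count (ltn^~ (nth 0 s n)) (drop n s) | n <- iota 0 5]%N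
  else 0.

Lemma epsilonE (i j k l m : 'I_5) :
  epsilon R i j k l m = (perm_sign [:: val i; val j; val k; val l; val m])%:~R.
Proof.
have n288 : 288 != 0 :> R by rewrite pnatr_eq0.
apply: (mulfI n288); rewrite epsilon_Vandermonde.
pose q (i j k l m : nat) : int :=
  (j%:Z - i%:Z) * (k%:Z - i%:Z) * (l%:Z - i%:Z) * (m%:Z - i%:Z) *
  (k%:Z - j%:Z) * (l%:Z - j%:Z) * (m%:Z - j%:Z) *
  (l%:Z - k%:Z) * (m%:Z - k%:Z) * (m%:Z - l%:Z).
(* Both sides are integers depending on five numbers below 5, so all 5^5 cases are checked by
   computation and then cast to [R]. *)
have /allP : all (fun i => all (fun j => all (fun k => all (fun l => all (fun m =>
    q i j k l m == 288%:Z * perm_sign [:: i; j; k; l; m])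
    (iota 0 5)) (iota 0 5)) (iota 0 5)) (iota 0 5)) (iota 0 5).
  by vm_compute.
have io (a : 'I_5) : val a \in iota 0 5 by rewrite mem_iota /= add0n ltn_ord.
move=> /(_ _ (io i))/allP/(_ _ (io j))/allP/(_ _ (io k))/allP/(_ _ (io l)).
move=> /allP/(_ _ (io m))/eqP/(congr1 (fun z : int => z%:~R : R)).
by rewrite /q !rmorphM !rmorphB.
Qed.

(** In the double sum each pair l, m occurs in both orders, which cancels the factor 1/2. The
    triples are those that [alternating3_eq] asks for. *)
Lemma star_e (b : 'M[R]_5) : two_form b ->
  [/\ star b (e_ 1) (e_ 2) (e_ 3) = b (e_ 4) (e_ 5),
      star b (e_ 1) (e_ 2) (e_ 4) = - b (e_ 3) (e_ 5),
      star b (e_ 1) (e_ 2) (e_ 5) = b (e_ 3) (e_ 4),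
      star b (e_ 1) (e_ 3) (e_ 4) = b (e_ 2) (e_ 5) &
      star b (e_ 1) (e_ 3) (e_ 5) = - b (e_ 2) (e_ 4)] /\
  [/\ star b (e_ 1) (e_ 4) (e_ 5) = b (e_ 2) (e_ 3),
      star b (e_ 2) (e_ 3) (e_ 4) = - b (e_ 1) (e_ 5),
      star b (e_ 2) (e_ 3) (e_ 5) = b (e_ 1) (e_ 4),
      star b (e_ 2) (e_ 4) (e_ 5) = - b (e_ 1) (e_ 3) &
      star b (e_ 3) (e_ 4) (e_ 5) = b (e_ 1) (e_ 2)].
Proof.
move=> /two_formP sb.
have s0 l : b l l = 0 by have := sb l l; lra.
split; split; rewrite /star !sum_e !epsilonE /= !inordK// !s0
  (sb (e_ 1) (e_ 2)) (sb (e_ 1) (e_ 3)) (sb (e_ 1) (e_ 4)) (sb (e_ 1) (e_ 5))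
  (sb (e_ 2) (e_ 3)) (sb (e_ 2) (e_ 4)) (sb (e_ 2) (e_ 5)) (sb (e_ 3) (e_ 4))
  (sb (e_ 3) (e_ 5)) (sb (e_ 4) (e_ 5)) /perm_sign /=; lra.
Qed.

Lemma Phi0_skew : two_form (Phi0 R).
Proof.
by apply/two_formP => i j; rewrite !mxE ![(j == _) && _]andbC; ring.
Qed.

Lemma Phi0_e5 (i : 'I_5) : Phi0 R i (e_ 5) = 0 /\ Phi0 R (e_ 5) i = 0.
Proof.
have sPhi : Phi0 R (e_ 5) i = - Phi0 R i (e_ 5) by have /two_formP := Phi0_skew.
suff h : Phi0 R i (e_ 5) = 0 by rewrite sPhi h oppr0.
by rewrite !mxE -!val_eqE /= !inordK//= !andbF !subr0 addr0.
Qed.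

Lemma Phi0_e :
  [/\ Phi0 R (e_ 1) (e_ 2) = 1, Phi0 R (e_ 1) (e_ 3) = 0, Phi0 R (e_ 1) (e_ 4) = 0,
      Phi0 R (e_ 2) (e_ 3) = 0 & Phi0 R (e_ 2) (e_ 4) = 0] /\
  Phi0 R (e_ 3) (e_ 4) = 1.
Proof.
by split; [split|]; rewrite !mxE -!val_eqE /= !inordK//= !(subr0, addr0, add0r).
Qed.

(** * The space Lambda^2_2 *)

Lemma alternating3_wedge22 (a b : 'M[R]_5) (i : 'I_5) :
  two_form a -> two_form b -> alternating3 (wedge22 a b i).
Proof.
move=> /two_formP sa /two_formP sb; split=> j k l; rewrite /wedge22.
  by rewrite (sa j k) (sb j k); ring.
by rewrite (sa k l) (sb k l); ring.
Qed.

(** Freezing the first index reduces the claim to [alternating3_eq] against the zero tensor. *)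
Lemma alternating4_eq0 (T : 'I_5 -> tensor3 R) :
  (forall i j k l, T j i k l = - T i j k l) -> (forall i, alternating3 (T i)) ->
  T (e_ 1) (e_ 2) (e_ 3) (e_ 4) = 0 -> T (e_ 1) (e_ 2) (e_ 3) (e_ 5) = 0 ->
  T (e_ 1) (e_ 2) (e_ 4) (e_ 5) = 0 -> T (e_ 1) (e_ 3) (e_ 4) (e_ 5) = 0 ->
  T (e_ 2) (e_ 3) (e_ 4) (e_ 5) = 0 -> forall i j k l, T i j k l = 0.
Proof.
move=> T1 alt.
pose E i j k l := T i j k l = 0.
have s1 i j k l : E j i k l -> E i j k l.
  by rewrite /E T1 => /eqP; rewrite oppr_eq0 => /eqP.
have s2 i j k l : E i k j l -> E i j k l.
  by rewrite /E (alt i).1 => /eqP; rewrite oppr_eq0 => /eqP.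
have s3 i j k l : E i j l k -> E i j k l.
  by rewrite /E (alt i).2 => /eqP; rewrite oppr_eq0 => /eqP.
have d1 i k l : E i i k l by rewrite /E; have := T1 i i k l; lra.
rewrite -!/(E _ _ _ _) => h1 h2 h3 h4 h5.
have alt0 : alternating3 (fun _ _ _ => 0 : R) by split=> *; rewrite oppr0.
elim/forall_e; apply: (alternating3_eq (alt _) alt0);
  rewrite -/(E _ _ _ _); auto 6 using s1, s2, s3, d1.
Qed.

(** On triples without e_5 the form eta /\ b vanishes, while the star of b returns the entries b_i5
    up to sign. On triples with e_5 the duality equation gives b_12 = b_34 and the last two
    relations. The 1234-component of Phi /\ b is b_12 + b_34, so both entries are zero. *)
Lemma Lambda2_2P (b : 'M[R]_5) : Lambda2_2 b <->
  [/\ two_form b, forall i, b i (e_ 5) = 0,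
      b (e_ 1) (e_ 2) = 0 /\ b (e_ 3) (e_ 4) = 0,
      b (e_ 1) (e_ 3) = - b (e_ 2) (e_ 4) & b (e_ 1) (e_ 4) = b (e_ 2) (e_ 3)].
Proof.
have [y1 y2 y3 y4 y5] := eta0_e.
split=> [[fb wb sb]|[fb b5 [b12 b34] b13 b14]].
  have [[h1 h2 h3 h4 h5] [h6 h7 h8 h9 h10]] := star_e fb.
  have w4 := wb (e_ 1) (e_ 2) (e_ 3) (e_ 4).
  move: w4 h1 h2 h3 h4 h5 h6 h7 h8 h9 h10; rewrite /wedge22 !sb /wedge12.
  rewrite y1 y2 y3 y4 y5 !mxE -!val_eqE /= !inordK//= => *.
  move/two_formP: (fb) => sk.
  have := sk (e_ 1) (e_ 5); have := sk (e_ 2) (e_ 5); have := sk (e_ 3) (e_ 5).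
  have := sk (e_ 4) (e_ 5); have := sk (e_ 5) (e_ 5) => *.
  by split=> //; [elim/forall_e|split| |]; lra.
move/two_formP: (fb) => sk.
have /two_formP sPhi := Phi0_skew.
have [[P12 P13 P14 P23 P24] P34] := Phi0_e.
have P5 i := (Phi0_e5 i).1.
have P := (P12, P13, P14, P23, P24, P34).
have b0 i : b i i = 0 by have := sk i i; lra.
have b5' i : b (e_ 5) i = 0 by rewrite sk b5 oppr0.
have w : forall i j k l, wedge22 (Phi0 R) b i j k l = 0.
{ apply: alternating4_eq0 => [i j k l|i|||||].
  - by rewrite /wedge22 (sPhi i j) (sk i j); ring.
  - exact: (alternating3_wedge22 _ Phi0_skew fb).
  all: rewrite /wedge22 ?(b0, b5, b5', b12, b34) ?b13 ?b14 ?P5 ?P; ring. }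
split=> //.
have [[h1 h2 h3 h4 h5] [h6 h7 h8 h9 h10]] := star_e fb.
apply: (alternating3_eq (alternating3_star b) (alternating3_wedge12 (eta0 R) fb));
  rewrite ?(h1, h2, h3, h4, h5, h6, h7, h8, h9, h10) /wedge12 ?(y1, y2, y3, y4, y5)
    ?(b5, b5', b12, b34) ?b13 ?b14; ring.
Qed.

(** Since [Phi0] is skew, this is the matrix form of b(phi u, phi v) = - b(u, v). *)
Lemma Lambda2_2_Phi0 (b : 'M[R]_5) :
  Lambda2_2 b -> Phi0 R *m b *m Phi0 R = b.
Proof.
move=> /Lambda2_2P[/two_formP sk b5 [b12 b34] b13 b14].
have b0 i : b i i = 0 by have := sk i i; lra.
have b5' i : b (e_ 5) i = 0 by rewrite sk b5 oppr0.
have /two_formP sPhi := Phi0_skew.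
have P0 i : Phi0 R i i = 0 by have := sPhi i i; lra.
have [[P12 P13 P14 P23 P24] P34] := Phi0_e.
have P5 i := Phi0_e5 i.
have P := (P12, P13, P14, P23, P24, P34).
have sP := (sPhi (e_ 1) (e_ 2), sPhi (e_ 1) (e_ 3), sPhi (e_ 1) (e_ 4),
  sPhi (e_ 2) (e_ 3), sPhi (e_ 2) (e_ 4), sPhi (e_ 3) (e_ 4)).
have mulE (A B : 'M[R]_5) i j : (A *m B) i j = A i (e_ 1) * B (e_ 1) j +
  A i (e_ 2) * B (e_ 2) j + A i (e_ 3) * B (e_ 3) j + A i (e_ 4) * B (e_ 4) j +
  A i (e_ 5) * B (e_ 5) j by rewrite mxE sum_e.
apply/matrixP; do 2 elim/forall_e; rewrite !mulE.
all: rewrite ?(P0, (P5 _).1, (P5 _).2) ?sP ?P ?(b0, b5, b5').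
all: rewrite ?(sk (e_ 1) (e_ 2), sk (e_ 1) (e_ 3), sk (e_ 1) (e_ 4),
  sk (e_ 2) (e_ 3), sk (e_ 2) (e_ 4), sk (e_ 3) (e_ 4)) ?(b12, b34) ?b13 ?b14; ring.
Qed.

(** * The splitting so(5) = u(2) + u(2)^perp and its projection *)

(** A 2-form on the span of e_1, ..., e_4. The fifth row is absent from the list; the defaults of
    the two [nth] make it zero. *)
Definition skew4 (a12 a13 a14 a23 a24 a34 : R) : 'M[R]_5 :=
  \matrix_(i, j) nth 0 (nth [::] [::
    [::    0;   a12;   a13;  a14; 0];
    [:: - a12;    0;   a23;  a24; 0];
    [:: - a13; - a23;    0;  a34; 0];
    [:: - a14; - a24; - a34;   0; 0]] i) j.

Lemma two_form_skew4 a12 a13 a14 a23 a24 a34 :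
  two_form (skew4 a12 a13 a14 a23 a24 a34).
Proof.
by apply/two_formP; do 2 elim/forall_e;
  rewrite !mxE !inordK//= ?nth_nil ?(oppr0, opprK).
Qed.

Lemma Phi0_skew4 : Phi0 R = skew4 1 0 0 0 0 1.
Proof.
have /two_formP sPhi := Phi0_skew.
have P0 i : Phi0 R i i = 0 by have := sPhi i i; lra.
have [[P12 P13 P14 P23 P24] P34] := Phi0_e.
have P5 i := Phi0_e5 i.
have P := (P12, P13, P14, P23, P24, P34).
have sP := (sPhi (e_ 1) (e_ 2), sPhi (e_ 1) (e_ 3), sPhi (e_ 1) (e_ 4),
  sPhi (e_ 2) (e_ 3), sPhi (e_ 2) (e_ 4), sPhi (e_ 3) (e_ 4)).
apply/matrixP; do 2 elim/forall_e;
  by rewrite ?(P0, (P5 _).1, (P5 _).2) ?sP ?P mxE !inordK//= ?nth_nil ?oppr0.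
Qed.

(** On triples from e_1, ..., e_4 the star of b takes the values b_i5 up to sign, while eta /\ b
    vanishes. *)
Lemma Lambda2_3_col5 (b : 'M[R]_5) (i : 'I_5) : Lambda2_3 b -> b i (e_ 5) = 0.
Proof.
case=> fb sb; have [y1 y2 y3 y4 _] := eta0_e.
have [[h1 h2 _ h4 _] [_ h7 _ _ _]] := star_e fb.
have /two_formP sk := fb.
move: i; elim/forall_e.
- by move: h7; rewrite sb /wedge12 y2 y3 y4; lra.
- by move: h4; rewrite sb /wedge12 y1 y3 y4; lra.
- by move: h2; rewrite sb /wedge12 y1 y2 y4; lra.
- by move: h1; rewrite sb /wedge12 y1 y2 y3; lra.
- by have := sk (e_ 5) (e_ 5); lra.
Qed.

Lemma u2_col5 (b : 'M[R]_5) (i : 'I_5) : u2 b -> b i (e_ 5) = 0.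
Proof.
case=> _ [t _ <-] [c hc <-].
by rewrite mxE (Lambda2_3_col5 i hc) mxE (Phi0_e5 i).1 mulr0 addr0.
Qed.

(** These are the anti-self-dual forms of the 4-plane spanned by e_1, ..., e_4. *)
Lemma Lambda2_3_skew4 (x y z : R) : Lambda2_3 (skew4 x y z (- z) y (- x)).
Proof.
have f := two_form_skew4 x y z (- z) y (- x); split=> //.
have [y1 y2 y3 y4 y5] := eta0_e.
have [w1 w2] := alternating3_wedge12 (eta0 R) f.
have alt : alternating3 (fun i j k =>
    - wedge12 (eta0 R) (skew4 x y z (- z) y (- x)) i j k).
  by split=> i j k; rewrite ?(w1 i j k) ?(w2 i j k).
have [[h1 h2 h3 h4 h5] [h6 h7 h8 h9 h10]] := star_e f.
apply: (alternating3_eq (alternating3_star _) alt);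
  rewrite ?(h1, h2, h3, h4, h5, h6, h7, h8, h9, h10) /wedge12
    ?(y1, y2, y3, y4, y5) !mxE !inordK//= ?nth_nil; ring.
Qed.

(** These are the self-dual forms of the same 4-plane that are orthogonal to Phi. *)
Lemma Lambda2_2_skew4 (x y : R) : Lambda2_2 (skew4 0 x y y (- x) 0).
Proof.
have f := two_form_skew4 0 x y y (- x) 0.
by apply/Lambda2_2P; split=> //; first elim/forall_e; do ?split;
  rewrite !mxE !inordK//= ?nth_nil ?opprK.
Qed.

(** Once the part on e_1, ..., e_4 is removed, what remains has the form eta /\ a. *)
Lemma Lambda2_4_sub_skew4 (b : 'M[R]_5) : two_form b ->
  Lambda2_4 (b - skew4 (b (e_ 1) (e_ 2)) (b (e_ 1) (e_ 3)) (b (e_ 1) (e_ 4))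
                (b (e_ 2) (e_ 3)) (b (e_ 2) (e_ 4)) (b (e_ 3) (e_ 4))).
Proof.
set s := skew4 _ _ _ _ _ _ => fb.
have fs : two_form s by exact: two_form_skew4.
have f : two_form (b - s) by rewrite /two_form linearB /= fb fs opprD.
have alt0 : alternating3 (fun _ _ _ => 0 : R) by split=> *; rewrite oppr0.
have [y1 y2 y3 y4 y5] := eta0_e.
split=> //; apply: (alternating3_eq (alternating3_wedge12 _ f) alt0);
  by rewrite /wedge12 ?(y1, y2, y3, y4, y5) !mxE !inordK//= ?nth_nil; ring.
Qed.

(* Only existence matters: [pr_u2_perp] is 0 where no decomposition exists. *)
Lemma u2_perp_u2 (w : 'M[R]_5) : two_form w -> exists a, u2_perp a /\ u2 (w - a).
Proof.
move=> fw.
have h4 := Lambda2_4_sub_skew4 fw.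
set s := skew4 _ _ _ _ _ _ in h4.
(* Half sums and differences split [s] into a self-dual part orthogonal to Phi ([x], [y]), a
   multiple [t] of Phi and an anti-self-dual part ([u], [v], [z]). *)
pose x := (w (e_ 1) (e_ 3) - w (e_ 2) (e_ 4)) / 2.
pose y := (w (e_ 1) (e_ 4) + w (e_ 2) (e_ 3)) / 2.
exists (skew4 0 x y y (- x) 0 + (w - s)); split.
  by exists (skew4 0 x y y (- x) 0); [exact: Lambda2_2_skew4|by exists (w - s)].
pose t := (w (e_ 1) (e_ 2) + w (e_ 3) (e_ 4)) / 2.
pose u := (w (e_ 1) (e_ 2) - w (e_ 3) (e_ 4)) / 2.
pose v := (w (e_ 1) (e_ 3) + w (e_ 2) (e_ 4)) / 2.
pose z := (w (e_ 1) (e_ 4) - w (e_ 2) (e_ 3)) / 2.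
exists (t *: Phi0 R); first by exists t.
exists (skew4 u v z (- z) v (- u)); first exact: Lambda2_3_skew4.
rewrite [w - _](_ : _ = s - skew4 0 x y y (- x) 0); last first.
  by rewrite opprD opprB addrCA [w + _]addrC subrK addrC.
rewrite Phi0_skew4 /s; apply/matrixP; do 2 elim/forall_e; rewrite !mxE !inordK//= ?nth_nil.
all: by rewrite /t /x /y /u /v /z; field.
Qed.

(** Whichever decomposition [xget] picks, [w] minus the chosen component lies in [u2] and so has
    zero last column. *)
Lemma pr_u2_perp_col5 (w : 'M[R]_5) (i : 'I_5) :
  two_form w -> pr_u2_perp w i (e_ 5) = w i (e_ 5).
Proof.
move=> /u2_perp_u2[a ha]; rewrite /pr_u2_perp.
have [_ /(u2_col5 i)] :=
  @xgetPex _ 0 [set a | u2_perp a /\ u2 (w - a)] (ex_intro _ a ha).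
by rewrite !mxE => /eqP; rewrite subr_eq0 => /eqP.
Qed.

(** * The components T(k, j, 5) of a tensor in W_4 + W_7 *)

Lemma Lambda2_2_star5 (b : 'M[R]_5) (k j : 'I_5) :
  Lambda2_2 b -> star b k j (e_ 5) = b k j.
Proof.
move=> hb; have [_ _ ->] := hb; case/Lambda2_2P: hb => /two_formP sb b5 _ _ _.
have [_ _ _ _ y5] := eta0_e.
by rewrite /wedge12 y5 b5 sb b5; ring.
Qed.

Lemma W4_plus_W7_col5 (T : tensor3 R) : W4_plus_W7 T ->
  exists b : 'M[R]_5, [/\ two_form b, Phi0 R *m b *m Phi0 R = b &
    forall k j, T k j (e_ 5) = b k j].
Proof.
case=> _ [_ [[b1 h1 <-] [b2 h2 <-] hT]].
(* The minus sign comes from [vartheta]: its first term 3 eta(e_k) b2(e_j, e_5) vanishes, which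
   leaves minus the star of b2. *)
exists (b1 - b2); split.
- case: h1 h2 => /two_formP s1 _ _ [/two_formP s2 _ _].
  by apply/two_formP => i j; rewrite !mxE s1 s2; ring.
- by rewrite mulmxBr mulmxBl !Lambda2_2_Phi0.
- move=> k j; rewrite hT /theta /vartheta !Lambda2_2_star5// !mxE.
  by case/Lambda2_2P: h2 => _ -> _ _ _; ring.
Qed.

End Model.

(** * Directional derivatives of matrix-valued functions *)

Section Derive.
Variables (R : realType) (V : normedModType R).

Lemma derivable_sumM n (F G : 'I_n -> V -> R) x v :
  (forall i, derivable (F i) x v) -> (forall i, derivable (G i) x v) ->
  derivable (fun y => \sum_i F i y * G i y) x v.
Proof.
move=> dF dG.
rewrite (_ : (fun y => _) = \sum_i (F i * G i)); last first.
  by apply/funext => y; rewrite fct_sumE.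
by apply: derivable_sum => i; apply: derivableM.
Qed.

Lemma derive_sumM n (F G : 'I_n -> V -> R) x v :
  (forall i, derivable (F i) x v) -> (forall i, derivable (G i) x v) ->
  'D_v (fun y => \sum_i F i y * G i y) x =
  \sum_i ('D_v (F i) x * G i x + F i x * 'D_v (G i) x).
Proof.
move=> dF dG.
rewrite (_ : (fun y => _) = \sum_i (F i * G i)); last first.
  by apply/funext => y; rewrite fct_sumE.
rewrite derive_sum; last by move=> i; apply: derivableM.
apply: eq_bigr => i _; rewrite deriveM// addrC; congr (_ + _).
by rewrite /GRing.scale/= mulrC.
Qed.

Lemma derivable_mulmx m n p (A : V -> 'M[R]_(m, n)) (B : V -> 'M[R]_(n, p)) x v :
  derivable A x v -> derivable B x v -> derivable (fun y => A y *m B y) x v.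
Proof.
move=> /derivable_mxP dA /derivable_mxP dB; apply/derivable_mxP => i j.
under eq_fun do rewrite mxE.
exact: derivable_sumM.
Qed.

Lemma derive_mulmx m n p (A : V -> 'M[R]_(m, n)) (B : V -> 'M[R]_(n, p)) x v :
  derivable A x v -> derivable B x v ->
  'D_v (fun y => A y *m B y) x = 'D_v A x *m B x + A x *m 'D_v B x.
Proof.
move=> dA dB; rewrite derive_mx; last exact: derivable_mulmx.
rewrite (derive_mx dA) (derive_mx dB).
move/derivable_mxP: dA => dA; move/derivable_mxP: dB => dB.
apply/matrixP => i j; rewrite !mxE.
under eq_fun do rewrite mxE.
rewrite derive_sumM// big_split; congr (_ + _); apply: eq_bigr => k _;
  by rewrite mxE.
Qed.

Lemma derivable_trmx m n (A : V -> 'M[R]_(m, n)) x v :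
  derivable A x v -> derivable (fun y => (A y)^T) x v.
Proof.
move=> /derivable_mxP dA; apply/derivable_mxP => i j.
under eq_fun do rewrite mxE.
exact: dA.
Qed.

Lemma derive_trmx m n (A : V -> 'M[R]_(m, n)) x v :
  derivable A x v -> 'D_v (fun y => (A y)^T) x = ('D_v A x)^T.
Proof.
move=> dA; rewrite derive_mx; last exact: derivable_trmx.
rewrite (derive_mx dA); apply/matrixP => i j; rewrite !mxE.
by under eq_fun do rewrite mxE.
Qed.

Lemma derive_coord m n (A : V -> 'M[R]_(m, n)) i j x v :
  derivable A x v -> 'D_v (fun y => A y i j) x = 'D_v A x i j.
Proof. by move=> dA; rewrite (derive_mx dA) mxE. Qed.

End Derive.

(** * Metric compatibility of the Levi-Civita connection *)

Section Fields.
Variables (R : realType) (n : nat) (M : smooth_manifold R n).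

(** By continuity of the inverse chart. It allows identities valid over an open set to be
    differentiated in coordinates. *)
Lemma near_region (U : set M) (c : chart M) (p : M) :
  open U -> U p -> dom c p -> \forall y \near coords c p, region c U y.
Proof.
move=> oU Up cp.
have Ip : (coords c @` dom c) (coords c p) by exists p.
have := @param_continuous _ _ M c.
move=> /subspace_continuousP /(_ _ Ip) cont.
have : nbhs (param c (coords c p)) (dom c `&` U).
  rewrite coordsK//; apply: open_nbhs_nbhs; split => //.
  by apply: openI => //; exact: dom_open.
move=> /cont; rewrite /nbhs/= /within/=.
have : \forall y \near coords c p, (coords c @` dom c) y.
  by apply: open_nbhs_nbhs; split => //; exact: image_open.
apply: filterS2 => _ [q cq <-] /(_ _)[]; first by exists q.
by rewrite /from_subspace coordsK// => _ Uq; exists q.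
Qed.

Lemma smooth_on_differentiable (W : normedModType R) (U : set 'rV[R]_n)
  (f : 'rV[R]_n -> W) x : smooth_on U f -> U x -> differentiable f x.
Proof. by move=> /(_ 1%N)[df _]; exact: df. Qed.

Variable g : riemannian_metric M.

Lemma metric_unit c x : region c setT x -> metric g c x \in unitmx.
Proof.
move=> cx; rewrite -row_free_unit; apply/inj_row_free => v v0.
apply/eqP; apply/negPn/negP => /(metric_pos g cx).
by rewrite /bilin v0 mul0mx mxE ltxx.
Qed.

Lemma bilinE (b : 'M[R]_n) u v :
  bilin b u v = \sum_i \sum_j u 0 i * b i j * v 0 j.
Proof.
rewrite /bilin -mulmxA mxE; apply: eq_bigr => i _.
by rewrite mxE mulr_sumr; apply: eq_bigr => j _; rewrite mxE mulrA.
Qed.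

Lemma bilin_tr (b : 'M[R]_n) u v : bilin b^T u v = bilin b v u.
Proof.
rewrite /bilin -[in RHS](trmxK (v *m _ *m _)) [in RHS]mxE.
by rewrite !trmx_mul trmxK mulmxA.
Qed.

Lemma bilinB (b b' : 'M[R]_n) u v : bilin (b - b') u v = bilin b u v - bilin b' u v.
Proof. by rewrite /bilin mulmxBr mulmxBl !mxE. Qed.

Lemma metric_coordC c x i j : region c setT x ->
  metric g c x i j = metric g c x j i.
Proof. by move=> cx; rewrite -[in LHS](Defs.metric_sym g cx) mxE. Qed.

(** Contracting with the metric cancels its inverse and yields the Christoffel symbols of the first
    kind. *)
Lemma christoffel_lower c x i j l : region c setT x ->
  \sum_k christoffel g c x k i j * metric g c x k l =
  2^-1 * (dmetric g c x i j l + dmetric g c x j i l - dmetric g c x l i j).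
Proof.
move=> cx; pose E m := dmetric g c x i j m + dmetric g c x j i m - dmetric g c x m i j.
rewrite -/(E l).
have -> : \sum_k christoffel g c x k i j * metric g c x k l =
    2^-1 * \sum_m (\sum_k metric g c x l k * invmx (metric g c x) k m) * E m.
  under eq_bigr => k _ do rewrite /christoffel -mulrA mulr_suml.
  rewrite -mulr_sumr exchange_big; congr (_ * _); apply: eq_bigr => m _.
  rewrite mulr_suml; apply: eq_bigr => k _.
  by rewrite (metric_coordC k l cx) -/(E m); ring.
under eq_bigr => m _.
  rewrite (_ : \sum_k _ = (l == m)%:R); last first.
    by have /matrixP/(_ l m) := mulmxV (metric_unit cx); rewrite !mxE.
  over.
rewrite (bigD1 l)//= eqxx mul1r big1 ?addr0// => m ml.
by rewrite eq_sym (negbTE ml) mul0r.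
Qed.

(** The zeroth-order term of [nabla], which depends only on the values of the two fields at the
    point. *)
Definition christoffel_row c x (u v : 'rV[R]_n) : 'rV[R]_n :=
  \row_k \sum_i \sum_j christoffel g c x k i j * u 0 i * v 0 j.

Lemma bilin_christoffel_row c x (u v w : 'rV[R]_n) : region c setT x ->
  bilin (metric g c x) (christoffel_row c x u v) w =
  \sum_i \sum_j \sum_l u 0 i * v 0 j * w 0 l *
    (2^-1 * (dmetric g c x i j l + dmetric g c x j i l - dmetric g c x l i j)).
Proof.
move=> cx; rewrite bilinE exchange_big /=.
under [RHS]eq_bigr do rewrite exchange_big /=.
rewrite [RHS]exchange_big /=; apply: eq_bigr => l _.
under eq_bigr => k _ do rewrite mxE mulr_suml mulr_suml.
rewrite exchange_big /=; apply: eq_bigr => i _.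
under eq_bigr => k _ do rewrite mulr_suml mulr_suml.
rewrite exchange_big /=; apply: eq_bigr => j _.
rewrite -(christoffel_lower _ _ _ cx) mulr_sumr; apply: eq_bigr => k _.
ring.
Qed.

Lemma bilin_metricC c x (u v : 'rV[R]_n) : region c setT x ->
  bilin (metric g c x) u v = bilin (metric g c x) v u.
Proof. by move=> cx; rewrite -bilin_tr (Defs.metric_sym g cx). Qed.

Lemma dmetricC c x i j l : region c setT x ->
  dmetric g c x i l j = dmetric g c x i j l.
Proof.
case=> p [cp _ <-]; apply: near_eq_derive.
have := near_region openT I cp; apply: filterS => y cy.
exact: metric_coordC.
Qed.

Lemma derive_metric c x (u : 'rV[R]_n) : region c setT x ->
  'D_u (metric g c) x = \matrix_(j, l) \sum_i u 0 i * dmetric g c x i j l.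
Proof.
move=> cx; have dg : differentiable (metric g c) x.
  exact: smooth_on_differentiable ((metric_form g).1 c) cx.
rewrite deriveE// [u in LHS]row_sum_delta linear_sum.
apply/matrixP => j l; rewrite summxE mxE; apply: eq_bigr => i _.
by rewrite linearZ mxE -deriveE// -derive_coord//; exact: diff_derivable.
Qed.

(** Metric compatibility, X g(Y, Z) = g(nabla_X Y, Z) + g(Y, nabla_X Z). *)
Lemma derive_bilin_metric X Y Z c x : region c setT x ->
  differentiable (Y c) x -> differentiable (Z c) x ->
  'D_(X c x) (fun y => bilin (metric g c y) (Y c y) (Z c y)) x =
  bilin (metric g c x) (nabla g X Y c x) (Z c x) +
  bilin (metric g c x) (Y c x) (nabla g X Z c x).
Proof.
move=> cx dY dZ.
have dg : differentiable (metric g c) x.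
  exact: smooth_on_differentiable ((metric_form g).1 c) cx.
have [vY vZ vg] : [/\ derivable (Y c) x (X c x), derivable (Z c) x (X c x) &
    derivable (metric g c) x (X c x)] by split; exact: diff_derivable.
have vYg := derivable_mulmx vY vg; have vZT := derivable_trmx vZ.
rewrite (derive_coord _ _ (derivable_mulmx vYg vZT)) (derive_mulmx vYg vZT).
rewrite (derive_mulmx vY vg) (derive_trmx vZ).
(* The product rule accounts for the derivatives of [Y] and [Z]; the derivative of the metric must
   match the two Christoffel terms. *)
suff key : bilin ('D_(X c x) (metric g c) x) (Y c x) (Z c x) =
    bilin (metric g c x) (christoffel_row c x (X c x) (Y c x)) (Z c x) +
    bilin (metric g c x) (Y c x) (christoffel_row c x (X c x) (Z c x)).
  rewrite /nabla -!/(christoffel_row c x _ _).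
  move: key; rewrite /bilin !(mulmxDl, linearD, mulmxDr) /= !mxE => key.
  by rewrite key; ring.
rewrite (bilin_metricC (Y c x) _ cx) !bilin_christoffel_row// -big_split bilinE /=.
rewrite derive_metric//.
under eq_bigr => j _ do under eq_bigr => l _ do
  rewrite mxE mulr_sumr mulr_suml.
under eq_bigr => j _ do rewrite exchange_big.
rewrite exchange_big /=; apply: eq_bigr => i _.
rewrite [X in _ + X]exchange_big -big_split; apply: eq_bigr => j _ /=.
rewrite -big_split; apply: eq_bigr => l _ /=.
(* In the sum of the two Christoffel symbols of the first kind everything cancels except d_i
   g_jl. *)
by rewrite !(dmetricC i l j, dmetricC l i j, dmetricC j l i)//; field.
Qed.

End Fields.

(** * The covariant and exterior derivatives of a 1-form as bilinear forms *)

Section Forms.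
Variables (R : realType) (n : nat) (M : smooth_manifold R n).
Variable g : riemannian_metric M.

(* The matrix of the bilinear form (u, v) |-> (nabla_u a)(v). *)
Definition cov_deriv (a : components M 'rV[R]_n) c x : 'M[R]_n :=
  jacobian (a c) x - \matrix_(i, j) \sum_k a c x 0 k * christoffel g c x k i j.

(** The derivative of [Y] cancels between the two terms of [nabla_form], so the value at [x] depends
    only on [X] and [Y] at [x]. *)
Lemma nabla_formE a X Y c x :
  differentiable (a c) x -> derivable (Y c) x (X c x) ->
  nabla_form g a X Y c x = bilin (cov_deriv a c x) (X c x) (Y c x).
Proof.
move=> da dY; rewrite /nabla_form /eval_form /nabla -/(christoffel_row g c x _ _).
have va : derivable (a c) x (X c x) by exact: diff_derivable.
have vYT := derivable_trmx dY.
rewrite /pairing (derive_coord _ _ (derivable_mulmx va vYT)).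
rewrite (derive_mulmx va vYT) (derive_trmx dY) (deriveEjacobian _ da).
rewrite linearD /= mulmxDr /bilin /cov_deriv mulmxBr mulmxBl.
set m := \matrix_(i, j) _.
suff -> : a c x *m (christoffel_row g c x (X c x) (Y c x))^T =
    X c x *m m *m (Y c x)^T by rewrite !mxE; ring.
apply/matrixP => i j; rewrite !ord1 -/(bilin m _ _) bilinE mxE.
under eq_bigr => k _ do rewrite !mxE mulr_sumr.
rewrite exchange_big; apply: eq_bigr => s _ /=.
under eq_bigr => k _ do rewrite mulr_sumr.
rewrite exchange_big; apply: eq_bigr => t _ /=.
by rewrite mxE mulr_sumr mulr_suml; apply: eq_bigr => k _; ring.
Qed.

Lemma ext_derivE a X Y c x : differentiable (a c) x ->
  derivable (X c) x (Y c x) -> derivable (Y c) x (X c x) ->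
  ext_deriv g a X Y c x =
  bilin (cov_deriv a c x - (cov_deriv a c x)^T) (X c x) (Y c x).
Proof.
by move=> da dX dY; rewrite /ext_deriv !nabla_formE// bilinB bilin_tr.
Qed.

End Forms.

(** * Adapted frames at a point *)

Section Frames.
Variables (R : realType) (M : smooth_manifold R 5) (g : riemannian_metric M).
Variables (A : almost_contact_metric g) (U : set M).
Variables (e : 'I_5 -> components M 'rV[R]_5) (c : chart M) (p : M).
Hypotheses (oU : open U) (Up : U p) (cp : dom c p).
Hypothesis he : adapted_frame A U e.

Let x := coords c p.
Let G := metric g c x.
Let E : 'M[R]_5 := \matrix_(i, j) e i c x 0 j.

Let xU : region c U x. Proof. by exists p. Qed.
Let xT : region c setT x. Proof. by exists p. Qed.

Lemma row_frame i : row i E = e i c x.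
Proof. by apply/rowP => j; rewrite !mxE. Qed.

Lemma frame_sandwich (b : 'M[R]_5) i j :
  (E *m b *m E^T) i j = bilin b (e i c x) (e j c x).
Proof.
rewrite /bilin -!row_frame -row_mul tr_row !mxE.
by apply: eq_bigr => k _; rewrite !mxE.
Qed.

Lemma frame_orthonormal : E *m G *m E^T = 1%:M.
Proof.
apply/matrixP => i j; rewrite frame_sandwich mxE.
by have [-> _ _] := he.2 c x xU i j.
Qed.

Lemma frame_unit : E \in unitmx.
Proof. by have := frame_orthonormal; rewrite -mulmxA => /mulmx1_unit[]. Qed.

(** The transpose comes from Phi(u, v) = g(u, phi v): the coefficient of phi(e_i) along e_k is
    Phi(e_k, e_i). *)
Lemma frame_phi : E *m acm_phi A c x = (Phi0 R)^T *m E.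
Proof.
have h : E *m G *m (E *m acm_phi A c x)^T = Phi0 R.
  apply/matrixP => i j; rewrite trmx_mul mulmxA.
  rewrite -(mulmxA E) frame_sandwich.
  have [_ <- _] := he.2 c x xU i j.
  by rewrite /fundamental_form /bilin trmx_mul !mulmxA.
have GEE : G *m E^T *m E = 1%:M.
  by apply: mulmx1C; rewrite mulmxA frame_orthonormal.
rewrite -h trmx_mul trmxK trmx_mul (Defs.metric_sym g xT).
by rewrite -!mulmxA [G *m _]mulmxA GEE mulmx1.
Qed.

(* That is, xi is the last vector of the frame. *)
Lemma frame_eta v : pairing (acm_eta A c x) v = bilin G (e (e_ 5) c x) v.
Proof.
suff -> : acm_eta A c x = e (e_ 5) c x *m G by [].
apply: (can_inj (mulmxK (_ : E^T \in unitmx))); first by rewrite unitmx_tr frame_unit.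
apply/rowP => j.
have [_ _ h] := he.2 c x xU (e_ 5) j.
have [h' _ _] := he.2 c x xU (e_ 5) j.
transitivity (pairing (acm_eta A c x) (e j c x)).
  by rewrite /pairing !mxE; apply: eq_bigr => k _; rewrite !mxE.
transitivity (bilin G (e (e_ 5) c x) (e j c x)).
  by rewrite h h' mxE /= eq_sym.
by rewrite /bilin !mxE; apply: eq_bigr => k _; rewrite !mxE.
Qed.

Lemma frame_differentiable i : differentiable (e i c) x.
Proof. exact: smooth_on_differentiable ((he.1 i).1 c) xU. Qed.

(** The functions g(e_i, e_j) are constant near [x], so metric compatibility gives g(nabla e_i, e_j)
    + g(e_i, nabla e_j) = 0. *)
Lemma two_form_Omega k : two_form (Omega g e c x k).
Proof.
apply/two_formP => i j; rewrite !mxE.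
have := derive_bilin_metric g (e k) xT (frame_differentiable i) (frame_differentiable j).
rewrite (near_eq_derive (g := cst ((i == j)%:R : R^o))); last first.
  have := near_region oU Up cp; apply: filterS => y yU.
  by have [-> _ _] := he.2 c y yU i j.
rewrite derive_cst (bilin_metricC g (e i c x) _ xT) => h.
by apply/eqP; rewrite -addr_eq0 addrC -h.
Qed.

Lemma eta_differentiable : differentiable (acm_eta A c) x.
Proof. exact: smooth_on_differentiable ((eta_form A).1 c) xT. Qed.

Lemma cov_deriv_eta_frame k j :
  bilin (cov_deriv g (acm_eta A) c x) (e k c x) (e j c x) =
  - Omega g e c x k j (e_ 5).
Proof.
rewrite -nabla_formE; [|exact: eta_differentiable|]; last first.
  exact/diff_derivable/frame_differentiable.
rewrite /nabla_form /eval_form.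
rewrite (near_eq_derive (g := cst (eta0 R 0 j : R^o))); last first.
  have := near_region oU Up cp; apply: filterS => y yU.
  by have [_ _ ->] := he.2 c y yU j j.
by rewrite derive_cst sub0r frame_eta (bilin_metricC g _ _ xT) mxE.
Qed.

End Frames.

(** * The identity for d eta, read in an adapted frame *)

Theorem proposition4p2 (R : realType) (M : smooth_manifold R 5)
  (g : riemannian_metric M) (A : almost_contact_metric g)
  (hA : of_class_W4_W7 A)
  (X Y : components M 'rV[R]_5)
  (hX : is_vector_field setT X) (hY : is_vector_field setT Y)
  (c : chart M) (p : M) (hp : dom c p) :
  ext_deriv g (acm_eta A) (apply_endo (acm_phi A) X) (apply_endo (acm_phi A) Y) c (coords c p)
  = - ext_deriv g (acm_eta A) X Y c (coords c p).
Proof.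
have [U [e [oU Up he /(_ c hp)/W4_plus_W7_col5[b [sb Pb hb]]]]] := hA p.
have xT : region c setT (coords c p) by exists p.
have deta := eta_differentiable A hp.
have dphi := smooth_on_differentiable ((phi_endo A).1 c) xT.
have dX := smooth_on_differentiable (hX.1 c) xT.
have dY := smooth_on_differentiable (hY.1 c) xT.
have dphiZ Z v : differentiable (Z c) (coords c p) ->
    derivable (apply_endo (acm_phi A) Z c) (coords c p) v.
  by move=> dZ; apply: derivable_mulmx; exact: diff_derivable.
(* Both sides become values of one bilinear form at the point, with matrix [D]; what remains is F D
   F^T = - D for the matrix [F] of phi. *)
rewrite (ext_derivE _ deta (dphiZ _ _ dX) (dphiZ _ _ dY)).
rewrite (ext_derivE _ deta (diff_derivable dX) (diff_derivable dY)).
set B := cov_deriv _ _ _ _; set x := coords c p; set D := B - B^T.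
pose E : 'M[R]_5 := \matrix_(i, j) e i c x 0 j.
(* The covariant derivative of eta in the frame: minus the last column of [Omega], which agrees with
   that of the intrinsic torsion. *)
have EB : E *m B *m E^T = - b.
  apply/matrixP => k j; rewrite frame_sandwich (cov_deriv_eta_frame oU Up hp he).
  rewrite [in RHS]mxE -hb.
  by rewrite /intrinsic_torsion pr_u2_perp_col5//; exact: two_form_Omega he k.
(* As [b] is skew, antisymmetrizing doubles it: d eta = - 2 b in the frame. *)
have ED : E *m D *m E^T = - (b *+ 2).
  have -> : E *m D *m E^T = E *m B *m E^T - (E *m B *m E^T)^T.
    by rewrite mulmxBr mulmxBl !trmx_mul trmxK mulmxA.
  by rewrite EB linearN /= sb opprK mulr2n opprD.
have Eu : E \in unitmx by exact: frame_unit he.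
set F := acm_phi A c x.
have EF : E *m F = (Phi0 R)^T *m E by exact: frame_phi hp he.
(* Conjugation by the invertible [E] replaces [F] by the transpose of [Phi0] and [D] by - 2 b, so
   the claim becomes Phi0 b Phi0 = b. *)
have FD : F *m D *m F^T = - D.
  apply: (can_inj (mulKmx Eu)); apply: (can_inj (mulmxK (_ : E^T \in unitmx))).
    by rewrite unitmx_tr.
  transitivity ((E *m F) *m D *m (E *m F)^T); first by rewrite trmx_mul !mulmxA.
  rewrite EF trmx_mul trmxK.
  transitivity ((Phi0 R)^T *m (E *m D *m E^T) *m Phi0 R); first by rewrite !mulmxA.
  rewrite mulmxN mulNmx ED (Phi0_skew R) mulmxN !mulNmx.
  by rewrite !opprK -scaler_nat -scalemxAr -scalemxAl Pb.
rewrite /bilin /apply_endo -/F trmx_mul !mulmxA.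
rewrite -(mulmxA (X c x) F D) -(mulmxA (X c x) _ F^T) FD.
by rewrite mulmxN mulNmx mxE.
Qed.
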